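(* Let $T$ and $V$ be oriented triangles. Then $T$ and $V$ are directly similar if and only if $\gamma_T=\gamma_V$ and $\mu_T=\mu_V$.
   Context: An oriented triangle is written as the ordered triple $T=(a,b,c)$ of its side lengths taken counterclockwise (positive reals with $|a-b|<c<a+b$). Oriented triangles $(a,b,c)$, $(x,y,z)$ are directly similar if $\frac ax=\frac by=\frac cz$ or $\frac ay=\frac bz=\frac cx$ or $\frac az=\frac bx=\frac cy$. A non-equilateral isosceles triangle is wide if its legs are shorter than its base. The cone angle $\gamma_T$ of $T=(a,b,c)$ is the angle between the vectors $(a^2,b^2,c^2)$ and $(1,1,1)$ in $\mathbb R^3$. For $\rho\in\mathbb R$, $\mathcal C_\rho(a,b,c)=(x_\rho,y_\rho,z_\rho)$ with $x_\rho=\sqrt{\rho a^2+(1-\rho)b^2+\rho(\rho-1)c^2}$, $y_\rho=\sqrt{(1-\rho)a^2+\rho(\rho-1)b^2+\rho c^2}$, $z_\rho=\sqrt{\rho(\rho-1)a^2+\rho b^2+(1-\rho)c^2}$ (again side lengths of an oriented triangle). For a non-equilateral $T$, $\mu_T$ is the unique number in $[0,1)$ such that $\mathcal C_{\mu_T}(T)$ is wide; for equilateral $T$ one sets $\mu_T=1$. *)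

(* Defs.v *)
From mathcomp Require Import all_boot all_order all_algebra.
From mathcomp Require Import all_classical all_reals all_analysis.
From mathcomp Require Import ring lra.

Set Implicit Arguments.
Unset Strict Implicit.
Unset Printing Implicit Defensive.

Import Order.TTheory GRing.Theory Num.Theory.

Local Open Scope classical_set_scope.
Local Open Scope ring_scope.

Record otriangle (R : realType) := OTriangle {
  side_a : R;
  side_b : R;
  side_c : R;
  side_a_gt0 : 0 < side_a;
  side_b_gt0 : 0 < side_b;
  side_c_gt0 : 0 < side_c;
  side_ineq : `|side_a - side_b| < side_c < side_a + side_b
}.

Definition directly_similar (R : realType) (T V : otriangle R) : Prop :=
  let: (a, b, c) := (side_a T, side_b T, side_c T) in
  let: (x, y, z) := (side_a V, side_b V, side_c V) in
  [\/ a / x = b / y /\ b / y = c / z,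
      a / y = b / z /\ b / z = c / x |
      a / z = b / x /\ b / x = c / y].

Definition equilateral (R : realType) (T : otriangle R) : bool :=
  (side_a T == side_b T) && (side_b T == side_c T).

(* In each case the two equal sides are the legs and the third is the base;
   the strict inequality rules out equilateral triangles. *)
Definition wide (R : realType) (T : otriangle R) : bool :=
  let: (a, b, c) := (side_a T, side_b T, side_c T) in
  [|| (a == b) && (a < c), (b == c) && (b < a) | (c == a) && (c < b)].

Definition dotmul (R : realType) (n : nat) (u v : 'rV[R]_n) : R :=
  (u *m v^T) 0 0.

(* The norm `|u| on row vectors is the sup norm, hence the explicit
   Euclidean norms here. *)
Definition vangle (R : realType) (n : nat) (u v : 'rV[R]_n) : R :=
  acos (dotmul u v / (Num.sqrt (dotmul u u) * Num.sqrt (dotmul v v))).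

Definition cone_angle (R : realType) (T : otriangle R) : R :=
  vangle (\row_(i < 3) [:: side_a T ^+ 2; side_b T ^+ 2; side_c T ^+ 2]`_i)
         (const_mx 1).

Section Cmap.
Variables (R : realType) (rho : R) (T : otriangle R).
Local Notation a := (side_a T).
Local Notation b := (side_b T).
Local Notation c := (side_c T).

Definition Cmap_a2 : R :=
  rho * a ^+ 2 + (1 - rho) * b ^+ 2 + rho * (rho - 1) * c ^+ 2.
Definition Cmap_b2 : R :=
  (1 - rho) * a ^+ 2 + rho * (rho - 1) * b ^+ 2 + rho * c ^+ 2.
Definition Cmap_c2 : R :=
  rho * (rho - 1) * a ^+ 2 + rho * b ^+ 2 + (1 - rho) * c ^+ 2.

(* Heron's formula: 16 times the squared area is positive. *)
Let heron_gt0 :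
  0 < 4 * a ^+ 2 * b ^+ 2 - (c ^+ 2 - a ^+ 2 - b ^+ 2) ^+ 2.
Proof.
have a0 := side_a_gt0 T; have b0 := side_b_gt0 T; have c0 := side_c_gt0 T.
have /andP[] := side_ineq T; rewrite ltr_norml => /andP[h1 h2] h3.
have -> : 4 * a ^+ 2 * b ^+ 2 - (c ^+ 2 - a ^+ 2 - b ^+ 2) ^+ 2 =
  (a + b + c) * (a + b - c) * ((c - (a - b)) * (c + (a - b))) by ring.
by rewrite !mulr_gt0//; lra.
Qed.

Let quad_gt0 (p q r : R) : 0 < p -> 0 < 4 * p * r - q ^+ 2 ->
  0 < p * rho ^+ 2 + q * rho + r.
Proof.
move=> p0 h; rewrite -(pmulr_rgt0 _ (_ : 0 < 4 * p)); last by rewrite mulr_gt0.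
have -> : 4 * p * (p * rho ^+ 2 + q * rho + r) =
  (2 * p * rho + q) ^+ 2 + (4 * p * r - q ^+ 2) by ring.
by rewrite ltr_wpDl// sqr_ge0.
Qed.

Let Cmap_a2_gt0 : 0 < Cmap_a2.
Proof.
have -> : Cmap_a2 = c ^+ 2 * rho ^+ 2 + (a ^+ 2 - b ^+ 2 - c ^+ 2) * rho
  + b ^+ 2 by rewrite /Cmap_a2; ring.
apply: quad_gt0; first by rewrite exprn_gt0// side_c_gt0.
by apply: lt_le_trans heron_gt0 _; rewrite le_eqVlt; apply/orP; left;
  apply/eqP; ring.
Qed.

Let Cmap_b2_gt0 : 0 < Cmap_b2.
Proof.
have -> : Cmap_b2 = b ^+ 2 * rho ^+ 2 + (c ^+ 2 - a ^+ 2 - b ^+ 2) * rho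
  + a ^+ 2 by rewrite /Cmap_b2; ring.
apply: quad_gt0; first by rewrite exprn_gt0// side_b_gt0.
by apply: lt_le_trans heron_gt0 _; rewrite le_eqVlt; apply/orP; left;
  apply/eqP; ring.
Qed.

Let Cmap_c2_gt0 : 0 < Cmap_c2.
Proof.
have -> : Cmap_c2 = a ^+ 2 * rho ^+ 2 + (b ^+ 2 - a ^+ 2 - c ^+ 2) * rho
  + c ^+ 2 by rewrite /Cmap_c2; ring.
apply: quad_gt0; first by rewrite exprn_gt0// side_a_gt0.
by apply: lt_le_trans heron_gt0 _; rewrite le_eqVlt; apply/orP; left;
  apply/eqP; ring.
Qed.

Lemma Cmap_side_ineq :
  `|Num.sqrt Cmap_a2 - Num.sqrt Cmap_b2| < Num.sqrt Cmap_c2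
    < Num.sqrt Cmap_a2 + Num.sqrt Cmap_b2.
Proof.
set x := Num.sqrt Cmap_a2; set y := Num.sqrt Cmap_b2.
set z := Num.sqrt Cmap_c2.
have x0 : 0 < x by rewrite sqrtr_gt0.
have y0 : 0 < y by rewrite sqrtr_gt0.
have z0 : 0 < z by rewrite sqrtr_gt0.
have Ex : x ^+ 2 = Cmap_a2 by rewrite sqr_sqrtr// ltW.
have Ey : y ^+ 2 = Cmap_b2 by rewrite sqr_sqrtr// ltW.
have Ez : z ^+ 2 = Cmap_c2 by rewrite sqr_sqrtr// ltW.
have H : 0 < 4 * x ^+ 2 * y ^+ 2 - (z ^+ 2 - x ^+ 2 - y ^+ 2) ^+ 2.
  rewrite Ex Ey Ez.
  have -> : 4 * Cmap_a2 * Cmap_b2 - (Cmap_c2 - Cmap_a2 - Cmap_b2) ^+ 2 =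
    (rho ^+ 2 - rho + 1) ^+ 2 *
    (4 * a ^+ 2 * b ^+ 2 - (c ^+ 2 - a ^+ 2 - b ^+ 2) ^+ 2).
    by rewrite /Cmap_a2 /Cmap_b2 /Cmap_c2; ring.
  rewrite mulr_gt0 ?heron_gt0// exprn_gt0//.
  have -> : rho ^+ 2 - rho + 1 = (rho - 1 / 2) ^+ 2 + 3 / 4 by field.
  by rewrite ltr_wpDl ?sqr_ge0//; lra.
have : `|z ^+ 2 - x ^+ 2 - y ^+ 2| < 2 * x * y.
  rewrite -(ltr_pXn2r (_ : 0 < 2)%N) ?nnegrE//; last first.
    by rewrite !mulr_ge0// ltW.
  by rewrite real_normK ?num_real// -subr_gt0; move: H; congr (0 < _); ring.
rewrite ltr_norml => /andP[h1 h2]; apply/andP; split.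
  rewrite -(ltr_pXn2r (_ : 0 < 2)%N) ?nnegrE//; last exact: ltW.
  rewrite real_normK ?num_real//.
  have -> : (x - y) ^+ 2 = x ^+ 2 + y ^+ 2 - 2 * x * y by ring.
  lra.
rewrite -(ltr_pXn2r (_ : 0 < 2)%N) ?nnegrE//; last 2 first.
- exact: ltW.
- by rewrite addr_ge0// ltW.
have -> : (x + y) ^+ 2 = x ^+ 2 + y ^+ 2 + 2 * x * y by ring.
lra.
Qed.

Lemma sqrt_Cmap_a2_gt0 : 0 < Num.sqrt Cmap_a2.
Proof. by rewrite sqrtr_gt0. Qed.

Lemma sqrt_Cmap_b2_gt0 : 0 < Num.sqrt Cmap_b2.
Proof. by rewrite sqrtr_gt0. Qed.

Lemma sqrt_Cmap_c2_gt0 : 0 < Num.sqrt Cmap_c2.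
Proof. by rewrite sqrtr_gt0. Qed.

Definition Cmap : otriangle R :=
  OTriangle sqrt_Cmap_a2_gt0 sqrt_Cmap_b2_gt0 sqrt_Cmap_c2_gt0 Cmap_side_ineq.

End Cmap.

(* This is mu_T. For T not equilateral exactly one m meets the condition, so the default
   value 0 of xget is never used. *)
Definition wide_param (R : realType) (T : otriangle R) : R :=
  if equilateral T then 1
  else xget 0 [set m : R | 0 <= m < 1 /\ wide (Cmap m T)].

(* Main.v *)
Require Import Defs.
From mathcomp Require Import all_boot all_order all_algebra.
From mathcomp Require Import all_classical all_reals all_analysis.
From mathcomp Require Import ring lra.

(** Everything is read off the squared side lengths [(A, B, C)] of a triangle.
    On them [Cmap m] acts by a symmetric matrix [M] whose square is
    [(m ^ 2 - m + 1) ^ 2] times the identity and which has [(1, 1, 1)] as an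
    eigenvector: up to the factor [m ^ 2 - m + 1] it is an orthogonal involution
    fixing the axis [(1, 1, 1)]. Hence [Cmap m] keeps the cone angle
    ([cone_angle_Cmap]) and is its own inverse up to a homothety
    ([homothetic_CmapK]).

    A wide triangle is determined up to direct similarity by its cone angle
    ([wide_homothetic]): its squared sides are, up to rotation, [(X, X, Z)] with
    [X < Z], and the angle fixes the ratio [(Z - X) / (2 * X + Z)]. So if two
    non-equilateral triangles [T] and [V] share the cone angle and the parameter
    [m], then [Cmap m T] and [Cmap m V] are wide with the same cone angle, hence
    directly similar, and applying [Cmap m] once more gives back [T] and [V].
    A suitable [m] with [0 <= m < 1] exists for every non-equilateral triangle
    ([exists_wide_param]), and [wide_param] picks one; for an equilateral triangle
    it is [1], which separates the two kinds.

    Conversely the cone angle and the set of all such [m] are invariant under homotheties and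
    under rotation of the sides, because [Cmap m] commutes with homotheties and
    turns one rotation into two. *)

Set Implicit Arguments.
Unset Strict Implicit.
Unset Printing Implicit Defensive.

Import Order.TTheory GRing.Theory Num.Theory.
Local Open Scope classical_set_scope.
Local Open Scope ring_scope.

(** * Rotations and homotheties *)

Section Triangles.
Variable R : realType.
Implicit Types (T V W : otriangle R) (m : R) (n : nat).

Lemma otriangle_eq T V :
  side_a T = side_a V -> side_b T = side_b V -> side_c T = side_c V -> T = V.
Proof.
case: T V => [a b c ha hb hc h] [x y z hx hy hz k] /= ea eb ec; subst.
by congr OTriangle; exact: bool_irrelevance.
Qed.

Fact rot_side_ineq T :
  `|side_b T - side_c T| < side_a T < side_b T + side_c T.
Proof.
have /andP[] := side_ineq T; rewrite ltr_norml => /andP[h1 h2] h3.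
by rewrite ltr_norml; apply/andP; split; [apply/andP; split|]; lra.
Qed.

Definition rotate T : otriangle R :=
  OTriangle (side_b_gt0 T) (side_c_gt0 T) (side_a_gt0 T) (rot_side_ineq T).

Lemma rotate3 T : rotate (rotate (rotate T)) = T.
Proof. exact: otriangle_eq. Qed.

Lemma iter_rotate3 n T : iter (3 * n) rotate T = T.
Proof. by elim: n => // n IHn; rewrite mulnS iterD /= IHn rotate3. Qed.

Definition homothetic T V : Prop := exists2 k, 0 < k &
  [/\ side_a T = k * side_a V, side_b T = k * side_b V
    & side_c T = k * side_c V].

Lemma homothetic_sym T V : homothetic T V -> homothetic V T.
Proof.
move=> [k k0 [ea eb ec]]; exists k^-1; first by rewrite invr_gt0.
by split; rewrite ?ea ?eb ?ec mulKf// gt_eqF.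
Qed.

Lemma homothetic_trans W T V :
  homothetic T W -> homothetic W V -> homothetic T V.
Proof.
move=> [k k0 [ea eb ec]] [l l0 [fa fb fc]]; exists (k * l); first exact: mulr_gt0.
by split; rewrite -mulrA -?fa -?fb -?fc.
Qed.

Lemma homothetic_rotate n T V :
  homothetic T V -> homothetic (iter n rotate T) (iter n rotate V).
Proof. by move=> TV; elim: n => //= n [k k0 [ea eb ec]]; exists k. Qed.

Lemma homothetic_sqr k T V : 0 < k ->
    side_a T ^+ 2 = k * side_a V ^+ 2 -> side_b T ^+ 2 = k * side_b V ^+ 2 ->
    side_c T ^+ 2 = k * side_c V ^+ 2 ->
  homothetic T V.
Proof.
have sqrE (x y : R) : 0 < x -> 0 < y -> 0 < k -> x ^+ 2 = k * y ^+ 2 ->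
    x = Num.sqrt k * y.
  move=> x0 y0 k0 e; apply/eqP.
  rewrite -(@eqrXn2 _ 2) ?(ltW x0) ?mulr_ge0 ?sqrtr_ge0 ?(ltW y0)//.
  by rewrite e exprMn sqr_sqrtr// ltW.
move=> k0 ea eb ec; exists (Num.sqrt k); first by rewrite sqrtr_gt0.
by split; apply: sqrE => //;
  first [exact: side_a_gt0 | exact: side_b_gt0 | exact: side_c_gt0].
Qed.

Lemma homothetic_ratioP T V : homothetic T V <->
  side_a T / side_a V = side_b T / side_b V /\
  side_b T / side_b V = side_c T / side_c V.
Proof.
have [x0 y0 z0] := And3 (side_a_gt0 V) (side_b_gt0 V) (side_c_gt0 V).
split=> [[k _ [-> -> ->]]|[e1 e2]]; first by rewrite !mulfK ?gt_eqF.
exists (side_a T / side_a V); first by rewrite divr_gt0 ?side_a_gt0.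
by split; [|rewrite e1|rewrite e1 e2]; rewrite divfK ?gt_eqF.
Qed.

Lemma directly_similarP T V :
  directly_similar T V <-> exists n, homothetic T (iter n rotate V).
Proof.
split=> [[/homothetic_ratioP h|h|h]|[n]].
- by exists 0%N.
- by exists 1%N; apply/homothetic_ratioP.
- by exists 2%N; apply/homothetic_ratioP.
rewrite (divn_eq n 3) addnC iterD mulnC iter_rotate3.
have : (n %% 3 < 3)%N by rewrite ltn_mod.
by case: (n %% 3)%N => [|[|[|//]]] _ /homothetic_ratioP h;
  [apply: Or31|apply: Or32|apply: Or33].
Qed.

(** * The cone angle *)

Lemma cone_angleE T :
  let s := side_a T ^+ 2 + side_b T ^+ 2 + side_c T ^+ 2 in
  let q := side_a T ^+ 4 + side_b T ^+ 4 + side_c T ^+ 4 in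
  cone_angle T = acos (s / (Num.sqrt q * Num.sqrt 3)).
Proof.
move=> s q; rewrite /cone_angle /vangle /dotmul; congr acos.
rewrite !mxE !big_ord_recl !big_ord0 !mxE /= /s /q.
congr (_ / (Num.sqrt _ * Num.sqrt _)); ring.
Qed.

Lemma cone_angle_eqP T V :
  cone_angle T = cone_angle V <->
  (side_a T ^+ 2 + side_b T ^+ 2 + side_c T ^+ 2) ^+ 2 *
    (side_a V ^+ 4 + side_b V ^+ 4 + side_c V ^+ 4) =
  (side_a V ^+ 2 + side_b V ^+ 2 + side_c V ^+ 2) ^+ 2 *
    (side_a T ^+ 4 + side_b T ^+ 4 + side_c T ^+ 4).
Proof.
pose s W := side_a W ^+ 2 + side_b W ^+ 2 + side_c W ^+ 2.
pose q W := side_a W ^+ 4 + side_b W ^+ 4 + side_c W ^+ 4.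
pose r W := s W / (Num.sqrt (q W) * Num.sqrt 3).
have q0 W : 0 < q W.
  by rewrite !addr_gt0// exprn_gt0// ?side_a_gt0 ?side_b_gt0 ?side_c_gt0.
have r0 W : 0 <= r W by rewrite divr_ge0 ?mulr_ge0 ?sqrtr_ge0 ?addr_ge0 ?sqr_ge0.
have rE W : r W ^+ 2 = s W ^+ 2 / (q W * 3).
  by rewrite /r expr_div_n exprMn !sqr_sqrtr// ltW.
have r1 W : r W \in `[-1, 1].
  rewrite in_itv /= (le_trans _ (r0 W)) ?lerN10//=.
  rewrite -(@expr_le1 _ 2)// rE ler_pdivrMr ?mulr_gt0// mul1r -subr_ge0.
  (* Lagrange's identity behind the Cauchy-Schwarz inequality *)
  have -> : q W * 3 - s W ^+ 2 = (side_a W ^+ 2 - side_b W ^+ 2) ^+ 2 +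
      (side_b W ^+ 2 - side_c W ^+ 2) ^+ 2 + (side_c W ^+ 2 - side_a W ^+ 2) ^+ 2.
    by rewrite /q /s; ring.
  by rewrite !addr_ge0 ?sqr_ge0.
rewrite !cone_angleE -!/(s _) -!/(q _) -!/(r _).
have -> : acos (r T) = acos (r V) <-> r T ^+ 2 = r V ^+ 2.
  split=> [/(congr1 cos)|/eqP]; first by rewrite !acosK// => ->.
  by rewrite eqrXn2// => /eqP ->.
rewrite !rE.
have q3 W : q W * 3 != 0 by rewrite gt_eqF ?mulr_gt0.
split=> [/eqP|e]; last apply/eqP; rewrite eqr_div//.
  by move=> /eqP e; lra.
by rewrite !mulrA e.
Qed.

Lemma cone_angle_homothetic T V : homothetic T V -> cone_angle T = cone_angle V.
Proof. by move=> [k k0 [ea eb ec]]; apply/cone_angle_eqP; rewrite ea eb ec; ring. Qed.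

Lemma cone_angle_rotate n T : cone_angle (iter n rotate T) = cone_angle T.
Proof. by elim: n => // n <-; apply/cone_angle_eqP => /=; ring. Qed.

(** * Behaviour of [Cmap] *)

Lemma side_a_Cmap m T : side_a (Cmap m T) ^+ 2 = Cmap_a2 m T.
Proof. by rewrite sqr_sqrtr// ltW// -sqrtr_gt0 sqrt_Cmap_a2_gt0. Qed.

Lemma side_b_Cmap m T : side_b (Cmap m T) ^+ 2 = Cmap_b2 m T.
Proof. by rewrite sqr_sqrtr// ltW// -sqrtr_gt0 sqrt_Cmap_b2_gt0. Qed.

Lemma side_c_Cmap m T : side_c (Cmap m T) ^+ 2 = Cmap_c2 m T.
Proof. by rewrite sqr_sqrtr// ltW// -sqrtr_gt0 sqrt_Cmap_c2_gt0. Qed.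

Let CmapE := (side_a_Cmap, side_b_Cmap, side_c_Cmap).

(** The matrix of [Cmap m] is constant along antidiagonals rather than
    diagonals, so rotating the argument rotates the value the other way. *)
Lemma Cmap_rotate m T : Cmap m (rotate T) = rotate (rotate (Cmap m T)).
Proof.
apply: otriangle_eq => /=; congr Num.sqrt;
  by rewrite /Cmap_a2 /Cmap_b2 /Cmap_c2 /=; ring.
Qed.

Lemma Cmap_iter_rotate m n T :
  Cmap m (iter n rotate T) = iter (2 * n) rotate (Cmap m T).
Proof. by elim: n => // n IHn; rewrite mulnS /= Cmap_rotate IHn. Qed.

Lemma homothetic_Cmap m T V : homothetic T V -> homothetic (Cmap m T) (Cmap m V).
Proof.
move=> [k k0 [ea eb ec]]; apply: (@homothetic_sqr (k ^+ 2)); rewrite ?exprn_gt0//.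
all: by rewrite !CmapE /Cmap_a2 /Cmap_b2 /Cmap_c2 ea eb ec; ring.
Qed.

Lemma homothetic_CmapK m T : homothetic (Cmap m (Cmap m T)) T.
Proof.
have m0 : 0 < m ^+ 2 - m + 1.
  have -> : m ^+ 2 - m + 1 = (m - 1 / 2) ^+ 2 + 3 / 4 by field.
  by rewrite ltr_wpDl ?sqr_ge0//; lra.
apply: (@homothetic_sqr ((m ^+ 2 - m + 1) ^+ 2)); rewrite ?exprn_gt0// !CmapE.
all: rewrite /Cmap_a2 /Cmap_b2 /Cmap_c2 !CmapE.
all: by rewrite /Cmap_a2 /Cmap_b2 /Cmap_c2; ring.
Qed.

Lemma cone_angle_Cmap m T : cone_angle (Cmap m T) = cone_angle T.
Proof.
apply/cone_angle_eqP.
have pow4 (x : R) : x ^+ 4 = (x ^+ 2) ^+ 2 by ring.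
by rewrite !(pow4 (_ (Cmap _ _))) !CmapE /Cmap_a2 /Cmap_b2 /Cmap_c2; ring.
Qed.

(** * Wide triangles *)

Lemma wide_homothetic_eq T V : homothetic T V -> wide T = wide V.
Proof.
move=> [k k0 [ea eb ec]]; rewrite /wide ea eb ec.
by rewrite !(inj_eq (mulfI (lt0r_neq0 k0))) !ltr_pM2l.
Qed.

Lemma wide_rotate n T : wide (iter n rotate T) = wide T.
Proof. by elim: n => // n <-; rewrite /wide /= orbA orbC. Qed.

Lemma wide_normalize T : wide T ->
  exists2 n, side_a (iter n rotate T) = side_b (iter n rotate T)
           & side_b (iter n rotate T) < side_c (iter n rotate T).
Proof.
case/or3P => /andP[/eqP e lt_e].
- by exists 0%N; rewrite //= -e.
- by exists 1%N; rewrite //= -e.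
- by exists 2%N; rewrite //= -e.
Qed.

Lemma wide_homothetic T V : wide T -> wide V -> cone_angle T = cone_angle V ->
  exists n, homothetic T (iter n rotate V).
Proof.
move=> /wide_normalize[i + +] /wide_normalize[j + +].
rewrite -(cone_angle_rotate i T) -(cone_angle_rotate j V) => + + + + /cone_angle_eqP.
set P := iter i rotate T; set Q := iter j rotate V => Pab Pbc Qab Qbc angle.
have [y0 z0 y'0 z'0] := And4 (side_b_gt0 P) (side_c_gt0 P) (side_b_gt0 Q) (side_c_gt0 Q).
rewrite Pab Qab in angle.
set Y := side_b P ^+ 2; set Z := side_c P ^+ 2.
set Y' := side_b Q ^+ 2; set Z' := side_c Q ^+ 2.
have [Y0 Y'0] : 0 < Y /\ 0 < Y' by rewrite !exprn_gt0.
have [YZ YZ'] : Y < Z /\ Y' < Z'.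
  by rewrite /Y /Z /Y' /Z' !ltr_pXn2r// nnegrE ltW.
(* The angle fixes [q / s ^ 2], for [s] the sum of the squared sides and [q] the
   sum of their squares; here [s = 2 * Y + Z] and
   [3 * q - s ^ 2 = 2 * (Z - Y) ^ 2]. *)
have : (Z - Y) * (2 * Y' + Z') = (Z' - Y') * (2 * Y + Z).
  apply/eqP; rewrite -(@eqrXn2 _ 2)// ?mulr_ge0 ?subr_ge0 ?addr_ge0//; try lra.
  rewrite -subr_eq0; apply/eqP; apply: (@mulfI _ 2) => //; rewrite mulr0.
  by move: angle; rewrite /Y /Z /Y' /Z' => angle; lra.
move=> ratio; exists (2 * i + j)%N.
suff PQ : homothetic P Q.
  have := homothetic_rotate (2 * i)%N PQ.
  by rewrite -!iterD -{2}(mul1n i) -mulnDl iter_rotate3.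
apply: (@homothetic_sqr (Y / Y')); rewrite ?divr_gt0// ?Pab ?Qab -/Y -/Y' ?divfK ?gt_eqF//.
rewrite -/Z -/Z' mulrAC; apply: (@mulIf _ Y'); first by rewrite gt_eqF.
by rewrite divfK ?gt_eqF//; lra.
Qed.

Lemma equilateral_homothetic T V : homothetic T V -> equilateral T = equilateral V.
Proof.
move=> [k k0 [ea eb ec]]; rewrite /equilateral ea eb ec.
by rewrite !(inj_eq (mulfI (lt0r_neq0 k0))).
Qed.

Lemma equilateral_rotate n T : equilateral (iter n rotate T) = equilateral T.
Proof.
elim: n => // n <-; rewrite /equilateral /=.
by apply/andP/andP => -[/eqP -> /eqP ->].
Qed.

(** With [u] and [v] the differences [B - A] and [C - A] of squared sides, the
    first two sides of [Cmap m T] agree iff [(v - u) * m ^ 2 - 2 * v * m + u = 0].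
    As [m] runs from [0] to [1] the squared sides move from [(B, A, C)] to
    [(A, C, B)], so the smallest one passes from the second place to the first;
    at the crossing the third side is the largest. *)
Lemma exists_wide_param_min T : side_a T <= side_b T -> side_a T < side_c T ->
  exists2 m, 0 <= m < 1 & wide (Cmap m T).
Proof.
move=> ab ac.
have [a0 b0 c0] := And3 (side_a_gt0 T) (side_b_gt0 T) (side_c_gt0 T).
pose u := side_b T ^+ 2 - side_a T ^+ 2; pose v := side_c T ^+ 2 - side_a T ^+ 2.
have u0 : 0 <= u by rewrite subr_ge0 ler_pXn2r// nnegrE ltW.
have v0 : 0 < v by rewrite subr_gt0 ltr_pXn2r// nnegrE ltW.
pose S := Num.sqrt (v ^+ 2 - u * v + u ^+ 2).
have S0 : 0 <= S by rewrite sqrtr_ge0.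
have SE : S ^+ 2 = v ^+ 2 - u * v + u ^+ 2.
  by rewrite sqr_sqrtr//; nra.
have D0 : 0 < v + S by lra.
have uD : u < v + S by nra.
(* [(v - S) / (v - u)] rationalized, so that [u = v] is no exception *)
pose m := u / (v + S).
have m01 : 0 <= m < 1 by rewrite divr_ge0 ?(ltW D0)//= ltr_pdivrMr// mul1r.
have root_m : (v - u) * m ^+ 2 - 2 * v * m + u = 0.
  have -> : (v - u) * m ^+ 2 - 2 * v * m + u =
      u * (S ^+ 2 - (v ^+ 2 - u * v + u ^+ 2)) / (v + S) ^+ 2.
    by rewrite /m; field; rewrite gt_eqF.
  by rewrite SE subrr mulr0 mul0r.
exists m => //; move: m01 root_m => /andP[]; move: m => m m0 m1 root_m.
have eXY : Cmap_a2 m T = Cmap_b2 m T.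
  apply/eqP; rewrite -subr_eq0 -root_m /Cmap_a2 /Cmap_b2 /u /v; apply/eqP; ring.
have ltXZ : Cmap_a2 m T < Cmap_c2 m T.
  have ZX : Cmap_c2 m T - Cmap_a2 m T = (2 * m - 1) * u + (1 - m ^+ 2) * v.
    by rewrite /Cmap_a2 /Cmap_c2 /u /v; ring.
  have ZY : Cmap_c2 m T - Cmap_a2 m T = m * (2 - m) * u + (1 - 2 * m) * v.
    by rewrite eXY /Cmap_b2 /Cmap_c2 /u /v; ring.
  rewrite -subr_gt0; have [m2|m2] := lerP (1 / 2) m.
    rewrite ZX ltr_wpDl// ?mulr_ge0 ?mulr_gt0//; first lra.
    by rewrite subr_gt0 expr_lt1.
  by rewrite ZY ltr_wpDl// ?mulr_ge0 ?mulr_gt0//; lra.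
apply/orP; left; rewrite /= eXY eqxx /= ltr_sqrt -?eXY//.
by rewrite (lt_trans _ ltXZ)// -sqrtr_gt0 sqrt_Cmap_a2_gt0.
Qed.

Lemma exists_wide_param T : ~~ equilateral T ->
  exists2 m, 0 <= m < 1 & wide (Cmap m T).
Proof.
(* The shortest side can be chosen so that the side before it, cyclically, is
   strictly longer. *)
move=> neq; have [n ab ac] : exists2 n,
    side_a (iter n rotate T) <= side_b (iter n rotate T) &
    side_a (iter n rotate T) < side_c (iter n rotate T).
  have [ac|ca] := ltrP (side_a T) (side_c T).
    have [ab|ba] := lerP (side_a T) (side_b T); first by exists 0%N.
    by exists 1%N => //=; lra.
  have [bc|cb] := ltrP (side_c T) (side_b T); first by exists 2%N => //=.
  have [ba|ab] := ltrP (side_b T) (side_a T); first by exists 1%N.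
  by move: neq; rewrite /equilateral !eq_le; lra.
have [m m01 wm] := exists_wide_param_min ab ac.
by exists m => //; rewrite Cmap_iter_rotate wide_rotate in wm.
Qed.

(** * The parameter [wide_param] *)

Lemma wide_param_directly_similar T V :
  directly_similar T V -> wide_param T = wide_param V.
Proof.
move=> /directly_similarP[n TV]; rewrite /wide_param.
rewrite (equilateral_homothetic TV) equilateral_rotate; case: ifP => // _.
congr (xget 0 _); apply/seteqP; split=> m /=;
  by rewrite (wide_homothetic_eq (homothetic_Cmap m TV)) Cmap_iter_rotate wide_rotate.
Qed.

Lemma wide_paramP T : ~~ equilateral T ->
  wide_param T < 1 /\ wide (Cmap (wide_param T) T).
Proof.
move=> neq; have [m m01 wm] := exists_wide_param neq.
rewrite /wide_param (negPf neq); case: xgetP => [l _ [/andP[_ ?]]//|/(_ m)].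
by case.
Qed.

Lemma wide_param_equilateral T : (wide_param T == 1) = equilateral T.
Proof.
have [eqT|/wide_paramP[lt1 _]] := boolP (equilateral T); last by rewrite lt_eqF.
by rewrite /wide_param eqT eqxx.
Qed.

End Triangles.

Theorem corollary11p5 (R : realType) (T V : otriangle R) :
  directly_similar T V <->
  cone_angle T = cone_angle V /\ wide_param T = wide_param V.
Proof.
split=> [TV|[angle param]].
  split; last exact: wide_param_directly_similar.
  have /directly_similarP[n /cone_angle_homothetic ->] := TV.
  exact: cone_angle_rotate.
have := wide_param_equilateral V; rewrite -param wide_param_equilateral.
have [/andP[/eqP ab /eqP bc] /esym/andP[/eqP xy /eqP yz]|neqT /esym/negbT neqV] :=
  boolP (equilateral T).
  by apply: Or31; rewrite ab bc xy yz.
have [_ wT] := wide_paramP neqT; have [_] := wide_paramP neqV.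
rewrite -param; move: (wide_param T) wT => m wT wV.
have [|n CTV] := wide_homothetic wT wV; first by rewrite !cone_angle_Cmap.
apply/directly_similarP; exists (2 * n)%N.
apply: homothetic_trans (homothetic_sym (homothetic_CmapK m T)) _.
apply: homothetic_trans (homothetic_Cmap m CTV) _.
by rewrite Cmap_iter_rotate; apply/homothetic_rotate/homothetic_CmapK.
Qed.
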